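(* Let $\Phi,\Psi$ be join doctrines with $\omega\in\Phi$ and $\Phi$ a sound join doctrine dual to $\Psi^{\mathrm{op}}$. For every $\Phi$-continuous lattice $X$, the evaluation map $\eta:X\to\mathbb{U}\Psi^{\mathrm{op}}\mathbf{Inf}(\Phi\mathbf{CtsLat}(X,\mathbb{I}),\mathbb{I})$, $\eta(x)(f)=f(x)$, is an order-isomorphism.
   Context: Join doctrine: class $\Phi$ of posets containing the one-element poset; closed under: unions $P=\bigcup\mathcal{S}$ of sets $\mathcal{S}$ of subposets in $\Phi$ with $\mathcal{S}$ (ordered by inclusion) in $\Phi$; codomains of monotone maps with cofinal image from members of $\Phi$; cofinal subposets of members. $\mathcal{L}(X)$ = lower sets of a poset $X$ (ordered by inclusion), $\Phi(X)$ = those lower sets lying in $\Phi$; $\Phi$-join = join of a subset in $\Phi$; $\Psi^{\mathrm{op}}$-meet = meet of a subset $S$ with $S^{\mathrm{op}}\in\Psi$; $\omega$ = naturals. $\Phi$ is sound dual to $\Psi^{\mathrm{op}}$ if $\bigwedge_{x\in\psi}\bigvee_{y\in\phi}F(x,y)=\bigvee_{y\in\phi}\bigwedge_{x\in\psi}F(x,y)$ for all posets $X,Y$, $\phi\in\Phi(Y)$, $\psi\in\Psi(X)$, monotone $F:X^{\mathrm{op}}\times Y\to 2$, and for every poset $X$ the closure of $\Psi(X)$ in $\mathcal{L}(X)$ under unions of subfamilies belonging to $\Phi$ is $\mathcal{L}(X)$. For a complete lattice $X$: $\Downarrow x=\bigcap\{\phi\in\Phi(X)\mid x\le\bigvee\phi\}$;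 $X$ is a $\Phi$-continuous lattice if every $x$ has $\phi\in\Phi(X)$ with $\phi\subseteq\Downarrow x$, $x\le\bigvee\phi$. $\Phi\mathbf{CtsLat}(X,\mathbb{I})$ = maps $X\to\mathbb{I}=[0,1]$ preserving arbitrary meets and $\Phi$-joins, with pointwise order, pointwise $\Psi^{\mathrm{op}}$-meets and pointwise action of $\mathbb{U}$ ($\mathbb{U}$ = monoid of surjective monotone self-maps of $\mathbb{I}$) given by $(u\cdot f)(x)=u(f(x))$; this is a $\mathbb{U}$-$\Psi^{\mathrm{op}}$-inflattice, i.e. a poset with a monotone (in both variables) $\mathbb{U}$-action and all $\Psi^{\mathrm{op}}$-meets preserved by each $u$. $\mathbb{U}\Psi^{\mathrm{op}}\mathbf{Inf}(B,\mathbb{I})$ = $\mathbb{U}$-equivariant monotone $\Psi^{\mathrm{op}}$-meet-preserving maps $B\to\mathbb{I}$, ordered pointwise. *)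

(* Defs.v *)
From Stdlib Require Import Reals.
Open Scope R_scope.

Definition PartialOrder {T : Type} (le : T -> T -> Prop) : Prop :=
  (forall x, le x x) /\ (forall x y z, le x y -> le y z -> le x z) /\
  (forall x y, le x y -> le y x -> x = y).

Definition subrel {T : Type} (le : T -> T -> Prop) (A : T -> Prop)
  : sig A -> sig A -> Prop := fun a b => le (proj1_sig a) (proj1_sig b).

Definition incl {T : Type} (S : (T -> Prop) -> Prop) : sig S -> sig S -> Prop :=
  fun A B => forall t, proj1_sig A t -> proj1_sig B t.

Definition oprel {T : Type} (le : T -> T -> Prop) : T -> T -> Prop :=
  fun a b => le b a.

Definition PosetClass := forall T : Type, (T -> T -> Prop) -> Prop.

Definition JoinDoctrine (Phi : PosetClass) : Prop :=
  Phi unit (fun _ _ => True) /\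
  (forall (T : Type) (le : T -> T -> Prop), PartialOrder le ->
     forall S : (T -> Prop) -> Prop,
     (forall A, S A -> Phi (sig A) (subrel le A)) ->
     Phi (sig S) (incl S) ->
     (forall t, exists A, S A /\ A t) ->
     Phi T le) /\
  (forall (T : Type) (leT : T -> T -> Prop) (U : Type) (leU : U -> U -> Prop)
          (f : T -> U),
     PartialOrder leT -> PartialOrder leU ->
     (forall x y, leT x y -> leU (f x) (f y)) ->
     (forall u, exists t, leU u (f t)) ->
     Phi T leT -> Phi U leU) /\
  (forall (T : Type) (le : T -> T -> Prop) (A : T -> Prop),
     PartialOrder le ->
     (forall t, exists a, A a /\ le t a) ->
     Phi T le -> Phi (sig A) (subrel le A)).

Definition LowerSet {X : Type} (le : X -> X -> Prop) (D : X -> Prop) : Prop :=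
  forall x y, le x y -> D y -> D x.

Definition PhiOf (Phi : PosetClass) {X : Type} (le : X -> X -> Prop)
  (D : X -> Prop) : Prop :=
  LowerSet le D /\ Phi (sig D) (subrel le D).

Definition SoundDual (Phi Psi : PosetClass) : Prop :=
  (forall (X : Type) (leX : X -> X -> Prop) (Y : Type) (leY : Y -> Y -> Prop),
     PartialOrder leX -> PartialOrder leY ->
     forall (phi : Y -> Prop) (psi : X -> Prop),
     PhiOf Phi leY phi -> PhiOf Psi leX psi ->
     forall F : X -> Y -> Prop,
     (forall x x' y y', leX x' x -> leY y y' -> F x y -> F x' y') ->
     ((forall x, psi x -> exists y, phi y /\ F x y) <->
      (exists y, phi y /\ forall x, psi x -> F x y))) /\
  (* the closure of Ψ(X) in L(X) under Φ-indexed unions is all of L(X) *)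
  (forall (X : Type) (leX : X -> X -> Prop), PartialOrder leX ->
     forall C : (X -> Prop) -> Prop,
     (forall psi, PhiOf Psi leX psi -> C psi) ->
     (forall S : (X -> Prop) -> Prop,
        (forall D, S D -> C D) -> Phi (sig S) (incl S) ->
        C (fun x => exists D, S D /\ D x)) ->
     forall D, LowerSet leX D -> C D).

Definition IsJoin {X : Type} (le : X -> X -> Prop) (S : X -> Prop) (j : X) : Prop :=
  (forall s, S s -> le s j) /\ (forall u, (forall s, S s -> le s u) -> le j u).

Definition IsMeet {X : Type} (le : X -> X -> Prop) (S : X -> Prop) (m : X) : Prop :=
  (forall s, S s -> le m s) /\ (forall u, (forall s, S s -> le u s) -> le u m).

Definition CompleteLattice {X : Type} (le : X -> X -> Prop) : Prop :=
  PartialOrder le /\ (forall S : X -> Prop, exists j, IsJoin le S j).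

Definition LeJoin {X : Type} (le : X -> X -> Prop) (x : X) (phi : X -> Prop) : Prop :=
  forall j, IsJoin le phi j -> le x j.

Definition DDown (Phi : PosetClass) {X : Type} (le : X -> X -> Prop) (x y : X) : Prop :=
  forall phi, PhiOf Phi le phi -> LeJoin le x phi -> phi y.

Definition PhiContinuousLattice (Phi : PosetClass) {X : Type}
  (le : X -> X -> Prop) : Prop :=
  CompleteLattice le /\
  forall x, exists phi, PhiOf Phi le phi /\
    (forall y, phi y -> DDown Phi le x y) /\ LeJoin le x phi.

Definition InI (r : R) : Prop := 0 <= r <= 1.

Definition IsInfI (S : R -> Prop) (m : R) : Prop :=
  InI m /\ (forall s, S s -> m <= s) /\
  (forall r, InI r -> (forall s, S s -> r <= s) -> r <= m).

Definition IsSupI (S : R -> Prop) (m : R) : Prop :=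
  InI m /\ (forall s, S s -> s <= m) /\
  (forall r, InI r -> (forall s, S s -> s <= r) -> m <= r).

Definition imageR {A : Type} (f : A -> R) (S : A -> Prop) : R -> Prop :=
  fun r => exists a, S a /\ f a = r.

Definition PhiCtsMap (Phi : PosetClass) {X : Type} (le : X -> X -> Prop)
  (f : X -> R) : Prop :=
  (forall x, InI (f x)) /\
  (forall (S : X -> Prop) m, IsMeet le S m -> IsInfI (imageR f S) (f m)) /\
  (forall (S : X -> Prop) j, Phi (sig S) (subrel le S) -> IsJoin le S j ->
     IsSupI (imageR f S) (f j)).

Definition CtsLatI (Phi : PosetClass) {X : Type} (le : X -> X -> Prop) : Type :=
  { f : X -> R | PhiCtsMap Phi le f }.

Definition leCts (Phi : PosetClass) {X : Type} (le : X -> X -> Prop)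
  (f g : CtsLatI Phi le) : Prop :=
  forall x, proj1_sig f x <= proj1_sig g x.

(** 𝕌 : surjective monotone self-maps of 𝕀 (represented by maps R -> R,
    only their restriction to [0,1] matters) *)
Definition UMap (u : R -> R) : Prop :=
  (forall r, InI r -> InI (u r)) /\
  (forall r s, InI r -> InI s -> r <= s -> u r <= u s) /\
  (forall s, InI s -> exists r, InI r /\ u r = s).

Definition UPsiInfMap (Phi Psi : PosetClass) {X : Type} (le : X -> X -> Prop)
  (g : CtsLatI Phi le -> R) : Prop :=
  (forall f, InI (g f)) /\
  (forall f f', leCts Phi le f f' -> g f <= g f') /\
  (* 𝕌-equivariant: g (u · f) = u (g f), where u · f has underlying map u ∘ f *)
  (forall u f f', UMap u -> (forall x, proj1_sig f' x = u (proj1_sig f x)) ->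
     g f' = u (g f)) /\
  (forall (S : CtsLatI Phi le -> Prop) m,
     Psi (sig S) (oprel (subrel (leCts Phi le) S)) ->
     IsMeet (leCts Phi le) S m ->
     IsInfI (imageR g S) (g m)).

Definition leFun {A : Type} (g h : A -> R) : Prop := forall a, g a <= h a.

Definition eta (Phi : PosetClass) {X : Type} (le : X -> X -> Prop) (x : X)
  : CtsLatI Phi le -> R := fun f => proj1_sig f x.

Definition OrderIsoOnto {A C : Type} (leA : A -> A -> Prop) (leC : C -> C -> Prop)
  (P : C -> Prop) (h : A -> C) : Prop :=
  (forall a, P (h a)) /\
  (forall a a', leA a a' <-> leC (h a) (h a')) /\
  (forall c, P c -> exists a, h a = c).

(* Main.v *)
Require Import Defs.
From Stdlib Require Import Reals.
From Stdlib Require Import Lra Lia Arith ZArith Classical ClassicalEpsilon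
  FunctionalExtensionality PropExtensionality ProofIrrelevance.
Open Scope R_scope.

(** Soundness makes every poset whose Ψ-subsets are bounded above a member of Φ.
    Given a U-equivariant Ψ^op-meet-preserving g, the opposite of
    E = {f | g f = 1} is such a poset, because Ψ^op-meets in ΦCtsLat(X, I) are
    pointwise.  Writing f^+ for the left adjoint of f, the point x representing g
    is the Φ-join of the f^+(1), f ∈ E.  Equivariance under t ↦ min(1, t/r) gives
    g f <= f x; conversely r <= f(e^+(1)) can be improved, since e^+(1) is the
    ω-join of the e^+(1 - 1/(n+1)), to r <= f(e^+(s)) up to an arbitrarily small
    loss with s < 1, and then rescaling both e and f by elements of U gives
    r <= g f.  That η reflects the order is Urysohn's lemma, by interpolation in
    the relation ≪ along the dyadic rationals. *)

(** * Extensionality and order preliminaries *)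

Lemma pred_ext {T : Type} (A B : T -> Prop) : (forall t, A t <-> B t) -> A = B.
Proof.
  intro H. apply functional_extensionality. intro t.
  apply propositional_extensionality. apply H.
Qed.

Lemma sig_ext {T : Type} (A : T -> Prop) (a b : sig A) :
  proj1_sig a = proj1_sig b -> a = b.
Proof.
  destruct a as [a ha], b as [b hb]. cbn. intros ->.
  f_equal. apply proof_irrelevance.
Qed.

Lemma PartialOrder_subrel {T : Type} (le : T -> T -> Prop) (A : T -> Prop) :
  PartialOrder le -> PartialOrder (subrel le A).
Proof.
  unfold subrel. intros [Hr [Ht Ha]]. split; [|split].
  - intro x. apply Hr.
  - intros x y z. apply Ht.
  - intros x y H1 H2. apply sig_ext. now apply Ha.
Qed.

Lemma PartialOrder_oprel {T : Type} (le : T -> T -> Prop) :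
  PartialOrder le -> PartialOrder (oprel le).
Proof.
  unfold oprel. intros [Hr [Ht Ha]]. split; [|split].
  - intro x. apply Hr.
  - intros x y z H1 H2. now apply Ht with y.
  - intros x y H1 H2. now apply Ha.
Qed.

Definition subset {T : Type} (A B : T -> Prop) : Prop := forall t, A t -> B t.

Lemma PartialOrder_subset {T : Type} : PartialOrder (@subset T).
Proof.
  unfold subset. split; [|split]; auto.
  intros A B H1 H2. apply pred_ext. intro t. split; auto.
Qed.

Lemma PartialOrder_incl {T : Type} (S : (T -> Prop) -> Prop) :
  PartialOrder (incl S).
Proof. exact (PartialOrder_subrel subset S PartialOrder_subset). Qed.

(** * Join doctrines and soundness *)

Section Doctrine.
Variable Phi : PosetClass.
Hypothesis HPhi : JoinDoctrine Phi.

Lemma Phi_cofinal_map (T : Type) (leT : T -> T -> Prop) (U : Type)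
  (leU : U -> U -> Prop) (f : T -> U) :
  PartialOrder leT -> PartialOrder leU ->
  (forall x y, leT x y -> leU (f x) (f y)) ->
  (forall u, exists t, leU u (f t)) ->
  Phi T leT -> Phi U leU.
Proof. destruct HPhi as [_ [_ [H _]]]. apply H. Qed.

Lemma Phi_image (T : Type) (leT : T -> T -> Prop) (U : Type)
  (leU : U -> U -> Prop) (f : T -> U) :
  PartialOrder leT -> PartialOrder leU ->
  (forall x y, leT x y -> leU (f x) (f y)) ->
  Phi T leT ->
  Phi (sig (fun u => exists t, f t = u)) (subrel leU (fun u => exists t, f t = u)).
Proof.
  intros HT HU Hm HP.
  apply (Phi_cofinal_map T leT _ _
           (fun t => exist (fun u => exists t, f t = u) (f t) (ex_intro _ t eq_refl)));
    auto using PartialOrder_subrel.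
  intros [u [t <-]]. exists t. apply (proj1 HU).
Qed.

Lemma Phi_sub_mono {T : Type} (le : T -> T -> Prop) (A B : T -> Prop) :
  PartialOrder le -> (forall t, A t -> B t) ->
  (forall t, B t -> exists a, A a /\ le t a) ->
  Phi (sig A) (subrel le A) -> Phi (sig B) (subrel le B).
Proof.
  intros HT HAB Hcof.
  apply (Phi_cofinal_map _ _ _ _
           (fun a : sig A => exist B (proj1_sig a) (HAB _ (proj2_sig a))));
    auto using PartialOrder_subrel.
  intros [t ht]. destruct (Hcof t ht) as [a [ha Hle]]. now exists (exist A a ha).
Qed.

Lemma Phi_full {T : Type} (le : T -> T -> Prop) :
  PartialOrder le -> Phi T le ->
  Phi (sig (fun _ : T => True)) (subrel le (fun _ => True)).
Proof.
  intros HT.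
  apply (Phi_cofinal_map _ _ _ _ (fun t => exist (fun _ : T => True) t I));
    auto using PartialOrder_subrel.
  intros [t []]. exists t. apply (proj1 HT).
Qed.

(** The constant map from the one-element poset to a greatest element has cofinal image. *)
Lemma Phi_greatest {T : Type} (le : T -> T -> Prop) (A : T -> Prop) (m : T) :
  PartialOrder le -> A m -> (forall t, A t -> le t m) ->
  Phi (sig A) (subrel le A).
Proof.
  intros HT Hm Hmax.
  apply (Phi_cofinal_map unit (fun _ _ => True) _ _ (fun _ => exist A m Hm)).
  - split; [|split]; auto. now intros [] [].
  - now apply PartialOrder_subrel.
  - intros _ _ _. apply (proj1 HT).
  - intros [t ht]. exists tt. now apply Hmax.
  - apply HPhi.
Qed.

Lemma PhiOf_principal {X : Type} (le : X -> X -> Prop) (x : X) :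
  PartialOrder le -> PhiOf Phi le (fun y => le y x).
Proof.
  intros HX. split.
  - intros a b Hab Hb. now apply (proj1 (proj2 HX)) with b.
  - apply Phi_greatest with x; auto. apply (proj1 HX).
Qed.

Lemma Phi_union {T : Type} (le : T -> T -> Prop) (J : Type)
  (leJ : J -> J -> Prop) (D : J -> T -> Prop) :
  PartialOrder le -> PartialOrder leJ -> Phi J leJ ->
  (forall i j, leJ i j -> forall t, D i t -> D j t) ->
  (forall j, Phi (sig (D j)) (subrel le (D j))) ->
  Phi (sig (fun t => exists j, D j t)) (subrel le (fun t => exists j, D j t)).
Proof.
  intros HT HJ HPJ Hmono HD.
  set (U := fun t => exists j, D j t).
  (* The union axiom speaks of families covering the whole carrier, so each [D j] is retraced as a
     subset of the subtype of the union. The family of traces is a monotone image of [J], hence in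
     [Phi]. *)
  set (tr := fun (j : J) (a : sig U) => D j (proj1_sig a)).
  destruct HPhi as [_ [Hunion _]].
  apply (Hunion (sig U) (subrel le U) (PartialOrder_subrel le U HT)
           (fun A => exists j, tr j = A)).
  - intros A [j <-].
    apply (Phi_cofinal_map (sig (D j)) (subrel le (D j)) _ _
      (fun a => exist (tr j) (exist U (proj1_sig a)
                  (ex_intro _ j (proj2_sig a))) (proj2_sig a)));
      auto using PartialOrder_subrel.
    intros [[t ht] htj]. exists (exist (D j) t htj). apply (proj1 HT).
  - apply (Phi_image J leJ (sig U -> Prop) subset tr); auto using PartialOrder_subset.
    intros i j Hij [t ht]. now apply Hmono.
  - intros [t [j Hj]]. exists (tr j). split; [now exists j|exact Hj].
Qed.

End Doctrine.

(** * Consequences of soundness *)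

(** The commutation law read on whole posets: witnesses [y] depending on [x] are traded for a
    uniform one. *)
Lemma sound_commute (Phi Psi : PosetClass) (X : Type) (leX : X -> X -> Prop)
  (Y : Type) (leY : Y -> Y -> Prop) (F : X -> Y -> Prop) :
  JoinDoctrine Phi -> JoinDoctrine Psi -> SoundDual Phi Psi ->
  PartialOrder leX -> PartialOrder leY -> Psi X leX -> Phi Y leY ->
  (forall x x' y y', leX x' x -> leY y y' -> F x y -> F x' y') ->
  (forall x, exists y, F x y) -> exists y, forall x, F x y.
Proof.
  intros HPhi HPsi [Hcomm _] HX HY HpX HpY Hmono H.
  destruct (Hcomm X leX Y leY HX HY (fun _ => True) (fun _ => True)) with (F := F)
    as [Hc _]; auto.
  - split; [now intros ? ?|now apply Phi_full].
  - split; [now intros ? ?|now apply Phi_full].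
  - destruct Hc as [y [_ Hy]].
    + intros x _. destruct (H x) as [y Hy]. now exists y.
    + exists y. auto.
Qed.

(** Induction on [D] along the generation of the lower sets from Ψ-lower sets by Φ-unions. A Ψ-lower
    set is the greatest Ψ-lower set inside itself, and the property passes to Φ-unions because Φ is
    closed under them. *)
Lemma sound_Phi_Psi_subsets (Phi Psi : PosetClass) (X : Type)
  (leX : X -> X -> Prop) (D : X -> Prop) :
  JoinDoctrine Phi -> JoinDoctrine Psi -> SoundDual Phi Psi ->
  PartialOrder leX -> LowerSet leX D ->
  let Q := fun psi => PhiOf Psi leX psi /\ subset psi D in
  Phi (sig Q) (subrel subset Q).
Proof.
  intros HPhi HPsi Hsd HX HD.
  set (Q := fun D psi => PhiOf Psi leX psi /\ subset psi D).
  change (Phi (sig (Q D)) (subrel subset (Q D))).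
  pose proof (@PartialOrder_subset X) as HS.
  apply (proj2 Hsd X leX HX
    (fun D => LowerSet leX D /\ Phi (sig (Q D)) (subrel subset (Q D)))); auto.
  - intros psi Hpsi. split; [apply Hpsi|]. apply Phi_greatest with psi; auto.
    + split; [assumption|now intros t].
    + intros t Ht. apply Ht.
  - intros S HSD HPS. split.
    { intros x y Hxy [A [HA Hy]]. exists A. split; [assumption|].
      now apply (proj1 (HSD A HA)) with y. }
    (* A Ψ-lower set covered by a Φ-family already lies in a single member, by [sound_commute]; so
       the Ψ-lower sets inside the union are those inside some member. *)
    replace (Q (fun x => exists D, S D /\ D x))
      with (fun psi => exists j : sig S, Q (proj1_sig j) psi).
    + apply (Phi_union Phi HPhi subset (sig S) (incl S) (fun j => Q (proj1_sig j)));
        auto using PartialOrder_incl.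
      * intros i j Hij t [H1 H2]. split; [assumption|].
        intros a Ha. now apply Hij, H2.
      * intros [A HA]. now apply HSD.
    + apply pred_ext. intro psi. split.
      * intros [[A HA] [H1 H2]]. split; [assumption|].
        intros t Ht. exists A. split; [assumption|now apply H2].
      * intros [H1 H2].
        destruct (sound_commute Phi Psi (sig psi) (subrel leX psi) (sig S) (incl S)
          (fun a A => proj1_sig A (proj1_sig a)))
          as [A HA]; auto using PartialOrder_incl, PartialOrder_subrel.
        -- apply H1.
        -- intros x x' [A HA] B Hx HAB Hax. apply HAB.
           now apply (proj1 (HSD A HA)) with (proj1_sig x).
        -- intros [t Ht]. destruct (H2 t Ht) as [A [HA Hat]].
           now exists (exist S A HA).
        -- exists A. split; [assumption|]. intros t Ht. exact (HA (exist psi t Ht)).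
Qed.

(* The principal lower sets are cofinal among the Ψ-lower sets of P, and the latter
   form a member of Φ by soundness. *)
Lemma sound_Psi_directed (Phi Psi : PosetClass) (P : Type) (le : P -> P -> Prop) :
  JoinDoctrine Phi -> JoinDoctrine Psi -> SoundDual Phi Psi ->
  PartialOrder le ->
  (forall psi, PhiOf Psi le psi -> exists u, forall t, psi t -> le t u) ->
  Phi P le.
Proof.
  intros HPhi HPsi Hsd HP Hub.
  set (Q := fun psi => PhiOf Psi le psi /\ subset psi (fun _ => True)).
  assert (HQ : Phi (sig Q) (subrel subset Q)).
  { apply (sound_Phi_Psi_subsets Phi Psi P le (fun _ => True)); auto. now intros ? ?. }
  set (Pr := fun q : sig Q => exists p, forall t, proj1_sig q t <-> le t p).
  assert (HPO : PartialOrder (subrel (@subset P) Q))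
    by apply PartialOrder_subrel, PartialOrder_subset.
  assert (HPr : Phi (sig Pr) (subrel (subrel subset Q) Pr)).
  { apply HPhi; auto.
    intros [psi [Hpsi Htop]]. destruct (Hub psi Hpsi) as [u Hu].
    assert (Hq : Q (fun t => le t u)).
    { split; [now apply PhiOf_principal|now intros t]. }
    exists (exist Q _ Hq). split; [now exists u|exact Hu]. }
  (* Sending a principal lower set to its generator is monotone and onto [P], which carries
     membership in [Phi] over to [P]. *)
  set (top := fun q : sig Pr =>
    proj1_sig (constructive_indefinite_description _ (proj2_sig q))).
  assert (Htop : forall q t, proj1_sig (proj1_sig q) t <-> le t (top q)).
  { intro q. exact (proj2_sig (constructive_indefinite_description _ (proj2_sig q))). }
  apply (Phi_cofinal_map Phi HPhi _ _ _ le top) in HPr; auto using PartialOrder_subrel.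
  - intros x y Hxy. apply Htop, Hxy, Htop, HP.
  - intros p.
    assert (Hq : Q (fun t => le t p)).
    { split; [now apply PhiOf_principal|now intros t]. }
    assert (Hpr : Pr (exist Q _ Hq)) by now exists p.
    exists (exist Pr _ Hpr). apply (Htop (exist Pr _ Hpr)). apply HP.
Qed.

(** * The relation ≪ *)

Section Continuous.
Variable Phi : PosetClass.
Hypothesis HPhi : JoinDoctrine Phi.
Variables (X : Type) (le : X -> X -> Prop).
Hypothesis HX : PhiContinuousLattice Phi le.

Let HPO : PartialOrder le := proj1 (proj1 HX).
Let le_refl : forall x, le x x := proj1 HPO.
Let le_trans : forall x y z, le x y -> le y z -> le x z := proj1 (proj2 HPO).

Lemma DDown_le (x x' y y' : X) :
  le x x' -> le y' y -> DDown Phi le x y -> DDown Phi le x' y'.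
Proof.
  intros Hx Hy H phi Hphi Hj. apply (proj1 Hphi) with y; auto.
  apply H; auto. intros j Hjj. apply le_trans with x'; auto.
Qed.

Lemma DDown_below (x y : X) : DDown Phi le x y -> le y x.
Proof.
  intro H. apply (H (fun z => le z x)).
  - now apply PhiOf_principal.
  - intros j Hj. now apply Hj.
Qed.

(** The set [phi] supplied by continuity is contained in [DDown Phi le x], and it contains it, being
    one of the sets intersected there. *)
Lemma DDown_PhiOf (x : X) :
  PhiOf Phi le (DDown Phi le x) /\ IsJoin le (DDown Phi le x) x.
Proof.
  destruct (proj2 HX x) as [phi [H1 [H2 H3]]].
  replace (DDown Phi le x) with phi.
  - split; [assumption|]. split.
    + intros s Hs. now apply DDown_below, H2.
    + intros u Hu. destruct (proj2 (proj1 HX) phi) as [j Hj].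
      apply le_trans with j; [now apply H3|]. now apply Hj.
  - apply pred_ext. intro y. split; [apply H2|]. intro Hy. now apply Hy.
Qed.

(** Here y ≪ x is written [DDown Phi le x y]. The union of the sets of elements ≪ z, over z ≪ x, is
    a Φ-lower set whose join is above x, so it contains y. *)
Lemma DDown_interpolate (x y : X) :
  DDown Phi le x y -> exists z, DDown Phi le x z /\ DDown Phi le z y.
Proof.
  intro H.
  destruct (H (fun t => exists z : sig (DDown Phi le x), DDown Phi le (proj1_sig z) t))
    as [[z Hz] Hy].
  - split.
    + intros a b Hab [z Hz]. exists z. now apply (DDown_le (proj1_sig z) _ b).
    + apply (Phi_union Phi HPhi le (sig (DDown Phi le x)) (subrel le _)
        (fun z => DDown Phi le (proj1_sig z))); auto using PartialOrder_subrel.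
      * apply DDown_PhiOf.
      * intros i j Hij t. now apply DDown_le.
      * intro z. apply DDown_PhiOf.
  - intros j Hj. apply (DDown_PhiOf x). intros z Hz. apply (DDown_PhiOf z).
    intros t Ht. apply Hj. now exists (exist _ z Hz).
  - now exists z.
Qed.

(** Tests the definition of ≪ on the lower closure of [S], in which [S] is cofinal. *)
Lemma DDown_Phi_join (S : X -> Prop) (j x y : X) :
  Phi (sig S) (subrel le S) -> IsJoin le S j -> le x j -> DDown Phi le x y ->
  exists s, S s /\ le y s.
Proof.
  intros HS Hj Hx H. apply (H (fun t => exists s, S s /\ le t s)).
  - split.
    + intros a b Hab [s [Hs Hb]]. exists s. split; [assumption|].
      now apply le_trans with b.
    + apply (Phi_sub_mono Phi HPhi le S); auto. intros t Ht. now exists t; auto.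
  - intros k Hk. apply le_trans with j; [assumption|]. apply Hj.
    intros s Hs. apply Hk. now exists s; auto.
Qed.

(** * Urysohn's lemma *)

(** The map is f z = sup of the values [val q] with [a q] below z. The final equivalence makes f
    preserve meets, since its right side does; Φ-joins use that consecutive scale points are related
    by ≪. *)
Lemma PhiCtsMap_of_scale (Q : Type) (val : Q -> R) (a : Q -> X) :
  (forall q, InI (val q)) ->
  (forall q q', val q < val q' -> DDown Phi le (a q') (a q)) ->
  (forall r s, 0 <= r -> r < s -> s <= 1 -> exists q, r < val q < s) ->
  exists f, PhiCtsMap Phi le f /\
    forall r z, InI r -> (r <= f z <-> forall q, val q < r -> le (a q) z).
Proof.
  intros Hval Hmono Hdense.
  (* Adding 0 keeps the set nonempty when no scale point lies below z. *)
  set (E := fun z r => r = 0 \/ exists q, val q = r /\ le (a q) z).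
  assert (HE : forall z r, E z r -> InI r).
  { intros z r [->|[q [<- _]]]; [unfold InI; lra|apply Hval]. }
  assert (Hb : forall z, bound (E z)).
  { intro z. exists 1. intros r Hr. apply HE in Hr. apply Hr. }
  assert (Hne : forall z, exists r, E z r) by (intro z; exists 0; now left).
  set (f := fun z => proj1_sig (completeness (E z) (Hb z) (Hne z))).
  assert (Hf : forall z, is_lub (E z) (f z))
    by (intro z; exact (proj2_sig (completeness (E z) (Hb z) (Hne z)))).
  assert (HfI : forall z, InI (f z)).
  { intro z. split; [apply (Hf z); now left|].
    apply (Hf z). intros r Hr. apply HE in Hr. apply Hr. }
  assert (Hq : forall q z, le (a q) z -> val q <= f z).
  { intros q z H. apply (Hf z). right. now exists q. }
  assert (Hchar : forall r z, InI r -> (r <= f z <-> forall q, val q < r -> le (a q) z)).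
  { intros r z Hr. split.
    - intros Hrf q Hqr. apply NNPP. intro Hn.
      assert (f z <= val q); [|lra].
      apply (Hf z). intros s [->|[q' [<- Hq']]]; [apply Hval|].
      destruct (Rle_or_lt (val q') (val q)) as [|Hlt]; [assumption|].
      exfalso. apply Hn. apply le_trans with (a q'); [|assumption].
      now apply DDown_below, Hmono.
    - intros H. apply Rnot_lt_le. intro Hlt.
      destruct (Hdense (f z) r) as [q Hqq]; try apply Hr; try apply HfI; auto.
      assert (val q <= f z) by (apply Hq, H; lra). lra. }
  assert (Hfm : forall y z, le y z -> f y <= f z).
  { intros y z Hyz. apply Hchar; [apply HfI|]. intros q Hqy.
    apply le_trans with y; [|assumption].
    now apply (proj1 (Hchar (f y) y (HfI y)) (Rle_refl _)). }
  exists f. split; [|exact Hchar]. split; [exact HfI|]. split.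
  - intros S m Hm. split; [apply HfI|]. split.
    + intros s [z [Hz <-]]. now apply Hfm, Hm.
    + intros r Hr H. apply Hchar; [assumption|]. intros q Hqr. apply Hm.
      intros s Hs. apply (proj1 (Hchar r s Hr)); [|assumption].
      apply H. now exists s.
  - intros S j HS Hj. split; [apply HfI|]. split.
    + intros s [z [Hz <-]]. now apply Hfm, Hj.
    + intros r Hr H. apply Rnot_lt_le. intro Hlt.
      (* Two values are chosen with r < [val q] < [val q'] < f j. Then [a q'] is below j and [a q] ≪
         [a q'], so [a q] is below some member s of [S], forcing f s > r. *)
      destruct (Hdense r (f j)) as [q' Hq']; try apply Hr; try apply HfI; auto.
      destruct (Hdense r (val q')) as [q Hqq']; try apply Hr; try apply Hval; try lra.
      destruct (DDown_Phi_join S j (a q') (a q)) as [s [Hs Has]]; auto.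
      * apply (proj1 (Hchar (f j) j (HfI j)) (Rle_refl _)). lra.
      * apply Hmono. lra.
      * apply Hq in Has. assert (f s <= r) by (apply H; now exists s). lra.
Qed.

(** Total, so that [dyadic] recurses without carrying proofs; the value is meaningful only when a ≪
    b. *)
Definition interpolant (b a : X) : X :=
  epsilon (inhabits a) (fun z => DDown Phi le b z /\ DDown Phi le z a).

Lemma interpolant_spec (b a : X) : DDown Phi le b a ->
  DDown Phi le b (interpolant b a) /\ DDown Phi le (interpolant b a) a.
Proof.
  intro H. unfold interpolant. apply epsilon_spec. now apply DDown_interpolate.
Qed.

(* [dyadic y x n k] stands at position k / 2^n between y (k = 0) and x (k = 2^n). *)
Fixpoint dyadic (y x : X) (n k : nat) : X :=
  match n with
  | O => match k with O => y | _ => x end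
  | S n => if Nat.even k then dyadic y x n (Nat.div2 k)
           else interpolant (dyadic y x n (S (Nat.div2 k))) (dyadic y x n (Nat.div2 k))
  end.

Lemma dyadic_double (y x : X) (n k : nat) :
  dyadic y x (S n) (2 * k) = dyadic y x n k.
Proof.
  cbn [dyadic]. now rewrite Nat.even_even, Nat.div2_double.
Qed.

(** Allows two scale points to be brought to a common denominator. *)
Lemma dyadic_refine (y x : X) (m n k : nat) :
  dyadic y x (m + n) (2 ^ m * k) = dyadic y x n k.
Proof.
  induction m as [|m IH].
  - f_equal. cbn. lia.
  - replace (2 ^ S m * k)%nat with (2 * (2 ^ m * k))%nat by (cbn; lia).
    change (S m + n)%nat with (S (m + n)). now rewrite dyadic_double.
Qed.

(** Of two neighbours at level n + 1, the even one comes from level n and the odd one is an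
    interpolant of it and the next point of level n. *)
Lemma dyadic_adjacent (y x : X) (n k : nat) : DDown Phi le x y ->
  (k < 2 ^ n)%nat -> DDown Phi le (dyadic y x n (S k)) (dyadic y x n k).
Proof.
  intro Hxy. revert k. induction n as [|n IH]; intros k Hk.
  - cbn in Hk. now replace k with 0%nat by lia.
  - rewrite Nat.pow_succ_r' in Hk.
    destruct (Nat.Even_or_Odd k) as [[i ->]|[i ->]].
    + rewrite dyadic_double. cbn [dyadic].
      replace (S (2 * i)) with (2 * i + 1)%nat by lia.
      rewrite Nat.even_odd. replace (2 * i + 1)%nat with (S (2 * i)) by lia.
      rewrite Nat.div2_succ_double. apply interpolant_spec. apply IH. lia.
    + replace (S (2 * i + 1)) with (2 * S i)%nat by lia.
      rewrite dyadic_double. cbn [dyadic]. rewrite Nat.even_odd.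
      replace (2 * i + 1)%nat with (S (2 * i)) by lia.
      rewrite Nat.div2_succ_double. apply interpolant_spec. apply IH. lia.
Qed.

Lemma dyadic_lt (y x : X) (n k l : nat) : DDown Phi le x y ->
  (k < l)%nat -> (l <= 2 ^ n)%nat ->
  DDown Phi le (dyadic y x n l) (dyadic y x n k).
Proof.
  intros Hxy Hkl. induction Hkl as [|l Hkl IH]; intro Hl.
  - now apply dyadic_adjacent.
  - apply (DDown_le (dyadic y x n l) _ (dyadic y x n k)); auto.
    + apply DDown_below, dyadic_adjacent; auto.
    + apply IH. lia.
Qed.

Lemma dyadic_dense (r s : R) : 0 <= r -> r < s ->
  exists n k : nat, r < INR k / 2 ^ n < s.
Proof.
  intros Hr Hrs.
  destruct (INR_unbounded (/ (s - r))) as [n Hn].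
  assert (H2n : INR n < 2 ^ n).
  { clear. induction n as [|n IH]; [cbn; lra|].
    rewrite S_INR. cbn [pow].
    assert (1 <= 2 ^ n) by (apply pow_R1_Rle; lra). lra. }
  assert (Hp : 0 < 2 ^ n) by (apply pow_lt; lra).
  assert (Hgap : 1 < (s - r) * 2 ^ n).
  { apply Rmult_lt_reg_l with (/ (s - r)); [apply Rinv_0_lt_compat; lra|].
    rewrite <- Rmult_assoc, Rinv_l by lra. lra. }
  (* The numerator is the least integer strictly above r 2^n; it exceeds r 2^n by at most 1, which
     is less than the gap (s - r) 2^n. *)
  destruct (archimed (r * 2 ^ n)) as [H1 H2].
  assert (Hz : (0 <= up (r * 2 ^ n))%Z).
  { apply le_IZR. apply Rle_trans with (r * 2 ^ n); [|lra].
    apply Rmult_le_pos; lra. }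
  exists n, (Z.to_nat (up (r * 2 ^ n))).
  rewrite INR_IZR_INZ, Z2Nat.id by assumption. split.
  - apply Rmult_lt_reg_r with (2 ^ n); [assumption|].
    unfold Rdiv. rewrite Rmult_assoc, Rinv_l by lra. lra.
  - apply Rmult_lt_reg_r with (2 ^ n); [assumption|].
    unfold Rdiv. rewrite Rmult_assoc, Rinv_l by lra. lra.
Qed.

Lemma Urysohn (x y : X) : DDown Phi le x y ->
  exists f, PhiCtsMap Phi le f /\ f x = 1 /\ forall z, ~ le y z -> f z = 0.
Proof.
  intro Hxy.
  (* Indices are pairs (n, k) standing for k / 2^n; one value may have several indices, since the
     scale compares only strictly different values. *)
  set (Q := {p : nat * nat | (snd p <= 2 ^ fst p)%nat}).
  set (val := fun q : Q => INR (snd (proj1_sig q)) / 2 ^ fst (proj1_sig q)).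
  set (a := fun q : Q => dyadic y x (fst (proj1_sig q)) (snd (proj1_sig q))).
  assert (Hp : forall n, 0 < 2 ^ n) by (intro n; apply pow_lt; lra).
  assert (HpI : forall n, INR (2 ^ n) = 2 ^ n) by (intro n; apply (pow_INR 2 n)).
  assert (Hlast : forall n, dyadic y x n (2 ^ n) = x).
  { intro n. transitivity (dyadic y x (n + 0) (2 ^ n * 1)); [f_equal; lia|].
    apply dyadic_refine. }
  destruct (PhiCtsMap_of_scale Q val a) as [f [Hf Hchar]].
  - intros [[n k] Hk]. unfold val, InI. cbn in *.
    apply le_INR in Hk. rewrite HpI in Hk. specialize (Hp n).
    pose proof (pos_INR k). split.
    + apply Rle_mult_inv_pos; lra.
    + apply Rmult_le_reg_r with (2 ^ n); [assumption|].
      unfold Rdiv. rewrite Rmult_assoc, Rinv_l by lra. lra.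
  - intros [[n k] Hk] [[n' k'] Hk']. unfold val, a. cbn [proj1_sig fst snd] in *.
    intro Hlt.
    rewrite <- (dyadic_refine y x n' n k), <- (dyadic_refine y x n n' k').
    rewrite (Nat.add_comm n n'). apply dyadic_lt; auto.
    + apply INR_lt. rewrite !mult_INR, !HpI.
      apply (Rmult_lt_compat_r (2 ^ n * 2 ^ n')) in Hlt;
        [|now apply Rmult_lt_0_compat].
      replace (INR k / 2 ^ n * (2 ^ n * 2 ^ n')) with (2 ^ n' * INR k) in Hlt
        by (field; apply Rgt_not_eq, Hp).
      replace (INR k' / 2 ^ n' * (2 ^ n * 2 ^ n')) with (2 ^ n * INR k') in Hlt
        by (field; apply Rgt_not_eq, Hp).
      assumption.
    + rewrite Nat.pow_add_r, (Nat.mul_comm (2 ^ n')). now apply Nat.mul_le_mono_l.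
  - intros r s Hr Hrs Hs. destruct (dyadic_dense r s Hr Hrs) as [n [k Hk]].
    assert (Hkn : (k <= 2 ^ n)%nat).
    { apply INR_le. rewrite HpI. apply Rmult_le_reg_r with (/ 2 ^ n).
      - now apply Rinv_0_lt_compat.
      - rewrite Rinv_r by apply Rgt_not_eq, Hp. unfold Rdiv in Hk. lra. }
    exists (exist _ (n, k) Hkn). exact Hk.
  - exists f. split; [assumption|]. destruct Hf as [HI _]. split.
    + apply Rle_antisym; [apply HI|]. apply Hchar; [unfold InI; lra|].
      intros [[n k] Hk] Hlt. unfold a. cbn [proj1_sig fst snd] in *.
      rewrite <- (Hlast n) at 2. destruct (proj1 (Nat.lt_eq_cases _ _) Hk) as [Hlt'|Heq].
      * apply DDown_below, dyadic_lt; auto.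
      * rewrite Heq. apply le_refl.
    + intros z Hz. apply Rle_antisym; [|apply HI]. apply Rnot_lt_le. intro Hlt.
      apply Hz.
      (* The index (0, 0) has value 0 and scale point y, so f z > 0 would put y below z. *)
      assert (H0 : (0 <= 2 ^ 0)%nat) by lia.
      apply (proj1 (Hchar (f z) z (HI z)) (Rle_refl _) (exist _ (0%nat, 0%nat) H0)).
      unfold val. cbn. lra.
Qed.

End Continuous.

(** * Maps to the unit interval *)

Section Maps.
Variables Phi Psi : PosetClass.
Hypothesis HPhi : JoinDoctrine Phi.
Hypothesis HPsi : JoinDoctrine Psi.
Hypothesis Homega : Phi nat Peano.le.
Hypothesis Hsound : SoundDual Phi Psi.
Variables (X : Type) (le : X -> X -> Prop).
Hypothesis HX : CompleteLattice le.

Let HPO : PartialOrder le := proj1 HX.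
Let B := CtsLatI Phi le.
Let leB := leCts Phi le.

Lemma PartialOrder_leCts : PartialOrder (leCts Phi le).
Proof.
  unfold leCts. split; [|split].
  - intros f x. apply Rle_refl.
  - intros f g h H1 H2 x. eapply Rle_trans; auto.
  - intros f g H1 H2. apply sig_ext, functional_extensionality.
    intro x. now apply Rle_antisym.
Qed.

Lemma PhiCtsMap_mono (f : X -> R) (x y : X) :
  PhiCtsMap Phi le f -> le x y -> f x <= f y.
Proof.
  intros [_ [Hf _]] Hxy.
  (* When x is below y, x is the meet of {x, y}. *)
  destruct (Hf (fun z => z = x \/ z = y) x) as [_ [H _]].
  - split; [|now auto]. intros s [->| ->]; [apply (proj1 HPO)|assumption].
  - apply H. exists y. auto.
Qed.

(** The infimum is the supremum of the lower bounds lying in I, so the empty set gets 1. *)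
Lemma IsInfI_exists (S : R -> Prop) :
  (forall s, S s -> InI s) -> exists m, IsInfI S m.
Proof.
  intro HS.
  destruct (completeness (fun r => InI r /\ forall s, S s -> r <= s)) as [m [H1 H2]].
  - exists 1. intros r [Hr _]. apply Hr.
  - exists 0. split; [unfold InI; lra|]. intros s Hs. now apply HS.
  - exists m. split; [split|split].
    + apply H1. split; [unfold InI; lra|]. intros s Hs. now apply HS.
    + apply H2. intros r [Hr _]. apply Hr.
    + intros s Hs. apply H2. intros r [_ Hr]. auto.
    + intros r Hr H. apply H1. auto.
Qed.

(** Pointwise infima commute with meets for formal reasons, and with Φ-joins by soundness. *)
Lemma pointwise_meet (S : B -> Prop) :
  Psi (sig S) (oprel (subrel leB S)) ->
  exists m : B, IsMeet leB S m /\
    forall x, IsInfI (imageR (fun f : B => proj1_sig f x) S) (proj1_sig m x).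
Proof.
  intro HS.
  destruct (choice (fun x r => IsInfI (imageR (fun f : B => proj1_sig f x) S) r))
    as [m Hm].
  { intro x. apply IsInfI_exists. intros s [f [Hf <-]]. apply (proj2_sig f). }
  assert (Hge : forall f x, S f -> m x <= proj1_sig f x).
  { intros f x Hf. apply (Hm x). now exists f. }
  assert (Hglb : forall r x, InI r -> (forall f, S f -> r <= proj1_sig f x) -> r <= m x).
  { intros r x Hr H. apply (Hm x); [assumption|]. intros s [f [Hf <-]]. auto. }
  assert (Hmm : forall x y, le x y -> m x <= m y).
  { intros x y Hxy. apply Hglb; [apply Hm|]. intros f Hf.
    apply Rle_trans with (proj1_sig f x); [auto|].
    apply PhiCtsMap_mono; [apply (proj2_sig f)|assumption]. }
  assert (HmB : PhiCtsMap Phi le m).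
  { split; [intro x; apply Hm|]. split.
    - intros T z Hz. split; [apply Hm|]. split.
      + intros s [t [Ht <-]]. now apply Hmm, Hz.
      + intros r Hr H. apply Hglb; [assumption|]. intros f Hf.
        apply (proj1 (proj2 (proj2_sig f)) T z Hz); [assumption|].
        intros s [t [Ht <-]]. apply Rle_trans with (m t); [|auto].
        apply H. now exists t.
    - intros T j HT Hj. split; [apply Hm|]. split.
      + intros s [t [Ht <-]]. now apply Hmm, Hj.
      + intros r Hr H. apply Rnot_lt_le. intro Hlt.
        (* Soundness concerns two-valued relations, so the real inequality is cut at a level r'
           strictly between: each f in [S] exceeds r' at some t in [T], hence all do at a common t,
           where m t >= r' > r. *)
        set (r' := (r + m j) / 2).
        assert (Hr' : r < r' < m j) by (unfold r'; lra).
        assert (Hr'I : InI r').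
        { destruct Hr. destruct (Hm j) as [[? ?] _]. unfold InI. lra. }
        destruct (sound_commute Phi Psi (sig S) (oprel (subrel leB S))
          (sig T) (subrel le T) (fun f t => r' < proj1_sig (proj1_sig f) (proj1_sig t)))
          as [[t Ht] Hall]; auto using PartialOrder_subrel, PartialOrder_oprel,
            PartialOrder_leCts.
        * intros f f' t t' Hff Htt Hlt'. eapply Rlt_le_trans; [exact Hlt'|].
          eapply Rle_trans; [apply Hff|].
          apply PhiCtsMap_mono; [apply (proj2_sig (proj1_sig f'))|exact Htt].
        * intros [f Hf]. cbn. apply NNPP. intro Hn.
          assert (proj1_sig f j <= r').
          { apply (proj2 (proj2 (proj2_sig f)) T j HT Hj); [assumption|].
            intros s [t [Ht <-]]. apply Rnot_lt_le. intro Hc.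
            apply Hn. now exists (exist T t Ht). }
          specialize (Hge f j Hf). lra.
        * assert (r' <= m t).
          { apply Hglb; [assumption|]. intros f Hf. left. exact (Hall (exist S f Hf)). }
          assert (m t <= r) by (apply H; now exists t). lra. }
  exists (exist _ m HmB). split; [|exact Hm]. split.
  - intros f Hf x. now apply Hge.
  - intros u Hu x. apply Hglb; [apply (proj2_sig u)|]. intros f Hf. now apply Hu.
Qed.

Lemma eta_UPsiInfMap (x : X) : UPsiInfMap Phi Psi le (eta Phi le x).
Proof.
  unfold eta. split; [|split; [|split]].
  - intro f. apply (proj2_sig f).
  - intros f f' H. apply H.
  - intros u f f' _ H. apply H.
  - intros S m HS Hm. destruct (pointwise_meet S HS) as [m' [Hm' Hpt]].
    replace m with m'; [apply Hpt|].
    apply PartialOrder_leCts; [apply Hm|apply Hm']; [apply Hm'|apply Hm].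
Qed.

(** * The action of U and two rescalings *)

(** A monotone surjection of I has no jumps, so it preserves infima and suprema. *)
Lemma UMap_comp (u : R -> R) (f : X -> R) :
  UMap u -> PhiCtsMap Phi le f -> PhiCtsMap Phi le (fun x => u (f x)).
Proof.
  intros [HuI [Hum Hus]] Hf. destruct (Hf) as [HI [Hmeet Hjoin]].
  split; [intro x; apply HuI, HI|]. split.
  - intros S m Hm. split; [apply HuI, HI|]. split.
    + intros s [z [Hz <-]]. apply Hum; auto.
      apply PhiCtsMap_mono; [assumption|now apply Hm].
    + intros r Hr H. apply Rnot_lt_le. intro Hlt.
      (* Surjectivity gives t with u t strictly between u (f m) and r. Every f z is at least t,
         hence so is f m, contradicting u (f m) < u t. *)
      destruct (Hus ((r + u (f m)) / 2)) as [t [Ht Hut]].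
      { destruct Hr. destruct (HuI _ (HI m)). unfold InI. lra. }
      assert (t <= f m).
      { apply (Hmeet S m Hm); [assumption|]. intros s [z [Hz <-]].
        apply Rnot_lt_le. intro Hc.
        assert (u (f z) <= u t) by (apply Hum; auto; lra).
        assert (r <= u (f z)) by (apply H; now exists z). lra. }
      assert (u t <= u (f m)) by (apply Hum; auto). lra.
  - intros S j HS Hj. split; [apply HuI, HI|]. split.
    + intros s [z [Hz <-]]. apply Hum; auto.
      apply PhiCtsMap_mono; [assumption|now apply Hj].
    + intros r Hr H. apply Rnot_lt_le. intro Hlt.
      destruct (Hus ((r + u (f j)) / 2)) as [t [Ht Hut]].
      { destruct Hr. destruct (HuI _ (HI j)). unfold InI. lra. }
      assert (f j <= t).
      { apply (Hjoin S j HS Hj); [assumption|]. intros s [z [Hz <-]].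
        apply Rnot_lt_le. intro Hc.
        assert (u t <= u (f z)) by (apply Hum; auto; lra).
        assert (u (f z) <= r) by (apply H; now exists z). lra. }
      assert (u (f j) <= u t) by (apply Hum; auto). lra.
Qed.

Definition Uact (u : R -> R) (Hu : UMap u) (f : B) : B :=
  exist _ _ (UMap_comp u (proj1_sig f) Hu (proj2_sig f)).

(** With [cap_eq_1], this turns the threshold r <= g f into the condition that g takes the value 1
    on the rescaled f. *)
Lemma UMap_cap (r : R) : 0 < r -> r <= 1 -> UMap (fun t => Rmin 1 (t / r)).
Proof.
  intros Hr Hr1. unfold UMap, InI.
  assert (Hi : 0 < / r) by now apply Rinv_0_lt_compat.
  split; [|split].
  - intros t Ht. split; [|apply Rmin_l].
    apply Rmin_glb; [lra|]. apply Rle_mult_inv_pos; lra.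
  - intros s t _ _ Hst. apply Rle_min_compat_l, Rmult_le_compat_r; lra.
  - intros s [Hs0 Hs1]. exists (s * r). split.
    { split; [apply Rmult_le_pos; lra|].
      rewrite <- (Rmult_1_l 1). apply Rmult_le_compat; lra. }
    replace (s * r / r) with s by (field; lra). apply Rmin_right. lra.
Qed.

Lemma cap_eq_1 (r t : R) : 0 < r -> Rmin 1 (t / r) = 1 <-> r <= t.
Proof.
  intro Hr. split.
  - intro H. assert (1 <= t / r) by (rewrite <- H; apply Rmin_r).
    replace t with (t / r * r) by (field; lra). nra.
  - intro H. apply Rmin_left. apply Rmult_le_reg_r with r; [assumption|].
    unfold Rdiv. rewrite Rmult_assoc, Rinv_l by lra. lra.
Qed.

(** Collapses [0, s] to 0 and stretches [s, 1] onto I, keeping 1 fixed; so a rescaled e vanishes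
    wherever e is below s. *)
Lemma UMap_cut (s : R) : 0 <= s -> s < 1 -> UMap (fun t => Rmax 0 ((t - s) / (1 - s))).
Proof.
  intros Hs Hs1. unfold UMap, InI.
  assert (Hi : 0 < / (1 - s)) by (apply Rinv_0_lt_compat; lra).
  split; [|split].
  - intros t Ht. split; [apply Rmax_l|].
    apply Rmax_lub; [lra|]. apply Rmult_le_reg_r with (1 - s); [lra|].
    unfold Rdiv. rewrite Rmult_assoc, Rinv_l by lra. lra.
  - intros a b _ _ Hab. apply Rle_max_compat_l, Rmult_le_compat_r; lra.
  - intros a [Ha0 Ha1]. exists (s + a * (1 - s)). split.
    { assert (0 <= a * (1 - s)) by (apply Rmult_le_pos; lra).
      assert (0 <= (1 - a) * (1 - s)) by (apply Rmult_le_pos; lra). lra. }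
    replace ((s + a * (1 - s) - s) / (1 - s)) with a by (field; lra).
    apply Rmax_right. lra.
Qed.

(** * Left adjoints and surjectivity of evaluation *)

Lemma adjoint_exists (p : B * R) :
  InI (snd p) -> exists y, forall z, le y z <-> snd p <= proj1_sig (fst p) z.
Proof.
  (* The adjoint value is the meet of {z | r <= f z}, built as the join of its lower bounds; f
     preserves this meet, so it belongs to the set. *)
  destruct p as [f r]. cbn. intro Hr.
  set (U := fun z => r <= proj1_sig f z).
  destruct (proj2 HX (fun y => forall z, U z -> le y z)) as [y Hy].
  assert (Hm : IsMeet le U y).
  { split.
    - intros z Hz. apply Hy. auto.
    - intros u Hu. apply Hy. exact Hu. }
  exists y. intro z. split.
  - intro Hyz. apply Rle_trans with (proj1_sig f y).
    + apply (proj1 (proj2 (proj2_sig f)) U y Hm); [assumption|].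
      now intros s [t [Ht <-]].
    + apply PhiCtsMap_mono; [apply (proj2_sig f)|assumption].
  - intro Hz. now apply Hm.
Qed.

Lemma adjoint_function :
  exists adj : B -> R -> X, forall f r z, InI r -> le (adj f r) z <-> r <= proj1_sig f z.
Proof.
  destruct (choice (fun (p : B * R) y =>
    InI (snd p) -> forall z, le y z <-> snd p <= proj1_sig (fst p) z)) as [adj H].
  - intro p. destruct (classic (InI (snd p))) as [Hp|Hp].
    + destruct (adjoint_exists p Hp) as [y Hy]. now exists y.
    (* For r outside I any element will do; the join of [X] is one. *)
    + destruct (proj2 HX (fun _ => True)) as [y _]. now exists y.
  - exists (fun f r => adj (f, r)). intros f r z Hr. now apply (H (f, r)).
Qed.

(* e^+(1) is the ω-join of the e^+(1 - 1/(n+1)), and f preserves it. *)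
Lemma adjoint_one_approx (adj : B -> R -> X) (e f : B) (r : R) :
  (forall f r z, InI r -> le (adj f r) z <-> r <= proj1_sig f z) ->
  0 <= r -> r < proj1_sig f (adj e 1) ->
  exists s, 0 <= s < 1 /\ r < proj1_sig f (adj e s).
Proof.
  intros Hadj Hr0 Hr.
  set (sq := fun n => 1 - / INR (S n)).
  assert (Hinv : forall n, 0 < / INR (S n) <= 1).
  { intro n. split; [apply Rinv_0_lt_compat, lt_0_INR; lia|].
    rewrite <- Rinv_1. apply Rinv_le_contravar; [lra|]. rewrite S_INR.
    pose proof (pos_INR n). lra. }
  assert (Hsq : forall n, 0 <= sq n < 1) by (intro n; unfold sq; specialize (Hinv n); lra).
  assert (HsqI : forall n, InI (sq n)) by (intro n; specialize (Hsq n); unfold InI; lra).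
  assert (H1I : InI 1) by (unfold InI; lra).
  pose proof (proj1 HPO) as Hrefl.
  apply NNPP. intro Hn.
  assert (Hle : proj1_sig f (adj e 1) <= r); [|lra].
  apply (proj2 (proj2 (proj2_sig f)) (fun y => exists n, adj e (sq n) = y)).
  - apply (Phi_image Phi HPhi nat Peano.le X le (fun n => adj e (sq n))); auto.
    + split; [|split]; [exact Nat.le_refl|exact Nat.le_trans|exact Nat.le_antisymm].
    + intros a b Hab. apply Hadj; [auto|].
      apply Rle_trans with (sq b); [|apply Hadj; auto].
      unfold sq. apply le_n_S, le_INR in Hab.
      pose proof (lt_0_INR (S a) (Nat.lt_0_succ a)).
      apply Rinv_le_contravar in Hab; lra.
  - split.
    + intros s [n <-]. apply Hadj; [auto|].
      apply Rle_trans with 1; [left; apply Hsq|]. apply Hadj; auto.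
    + intros u Hu. apply Hadj; [auto|]. apply Rnot_lt_le. intro Hlt.
      (* If e u < 1, some [sq n] exceeds e u, although u bounds [adj e (sq n)]. *)
      destruct (INR_unbounded (/ (1 - proj1_sig e u))) as [n Hnn].
      assert (Hsn : sq n <= proj1_sig e u).
      { apply Hadj; [auto|]. apply Hu. now exists n. }
      assert (/ INR (S n) < 1 - proj1_sig e u); [|unfold sq in Hsn; lra].
      rewrite <- (Rinv_inv (1 - proj1_sig e u)).
      apply Rinv_lt_contravar.
      * apply Rmult_lt_0_compat; [apply Rinv_0_lt_compat; lra|apply lt_0_INR; lia].
      * rewrite S_INR. lra.
  - split; [assumption|]. pose proof (proj1 (proj2_sig f) (adj e 1)) as [_ ?]. lra.
  - intros s [y [[n <-] <-]]. apply Rnot_lt_le. intro Hlt. apply Hn.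
    exists (sq n). auto.
Qed.

(* Ψ-subsets of {f | g f = 1}^op are bounded, by their pointwise meets. *)
Lemma Phi_unit_fibre (g : B -> R) : UPsiInfMap Phi Psi le g ->
  Phi (sig (fun f => g f = 1)) (oprel (subrel leB (fun f => g f = 1))).
Proof.
  intros [HgI [_ [_ Hg]]]. set (E := fun f => g f = 1).
  apply (sound_Psi_directed Phi Psi); auto using PartialOrder_oprel,
    PartialOrder_subrel, PartialOrder_leCts.
  intros psi [_ Hpsi].
  set (S := fun f => exists e : sig psi, proj1_sig (proj1_sig e) = f).
  assert (HS : Psi (sig S) (oprel (subrel leB S))).
  { apply (Phi_image Psi HPsi (sig psi) _ B (oprel leB)
             (fun e => proj1_sig (proj1_sig e))) in Hpsi; auto using
      PartialOrder_oprel, PartialOrder_subrel, PartialOrder_leCts. }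
  destruct (pointwise_meet S HS) as [m [Hm _]].
  assert (HmE : E m).
  { apply Rle_antisym; [apply HgI|]. apply (Hg S m HS Hm); [unfold InI; lra|].
    intros s [f [[[[f' Hf'] Hp] <-] <-]]. right. symmetry. exact Hf'. }
  exists (exist E m HmE). intros e He. apply Hm. now exists (exist psi e He).
Qed.

Lemma eta_surjective (g : B -> R) :
  UPsiInfMap Phi Psi le g -> exists x, eta Phi le x = g.
Proof.
  intro Hg. pose proof (Phi_unit_fibre g Hg) as HE.
  destruct Hg as [HgI [Hgm [Hgu _]]]. set (E := fun f => g f = 1) in HE.
  destruct adjoint_function as [adj Hadj].
  pose proof (proj1 HPO) as Hrefl.
  assert (H1I : InI 1) by (unfold InI; lra).
  set (J := fun y => exists e : sig E, adj (proj1_sig e) 1 = y).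
  assert (HJ : Phi (sig J) (subrel le J)).
  { apply (Phi_image Phi HPhi _ _ X le (fun e : sig E => adj (proj1_sig e) 1)) in HE;
      auto using PartialOrder_oprel, PartialOrder_subrel, PartialOrder_leCts.
    (* Adjoints reverse the order of maps, and [E] carries the opposite order, so the map to [J] is
       monotone. *)
    intros e e' Hee. apply Hadj; [assumption|].
    apply Rle_trans with (proj1_sig (proj1_sig e') (adj (proj1_sig e') 1)).
    - now apply Hadj.
    - apply Hee. }
  destruct (proj2 HX J) as [x Hx]. exists x.
  apply functional_extensionality. intro f. unfold eta.
  pose proof (proj1 (proj2_sig f)) as HfI.
  apply Rle_antisym.
  - apply (proj2 (proj2 (proj2_sig f)) J x HJ Hx); [apply HgI|].
    intros s [y [[[e He] <-] <-]]. cbn. apply Rnot_lt_le. intro Hlt.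
    destruct (adjoint_one_approx adj e f (g f) Hadj) as [s [Hs Hrs]];
      [apply HgI|assumption|].
    set (r := proj1_sig f (adj e s)) in Hrs.
    assert (Hr0 : 0 < r) by (apply Rle_lt_trans with (g f); [apply HgI|assumption]).
    assert (Hr1 : r <= 1) by apply HfI.
    set (ue := Uact _ (UMap_cut s (proj1 Hs) (proj2 Hs)) e).
    set (vf := Uact _ (UMap_cap r Hr0 Hr1) f).
    (* Where e z >= s, z is above [adj e s], so f z >= r and [vf] is 1; elsewhere [ue] is 0.
       Applying g, with g e = 1, gives 1 <= min(1, g f / r), that is r <= g f, against g f < r. *)
    assert (Hle : leB ue vf).
    { intro z. cbn. destruct (Rle_or_lt s (proj1_sig e z)) as [Hz|Hz].
      - apply Hadj in Hz; [|unfold InI; lra].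
        apply (PhiCtsMap_mono _ _ _ (proj2_sig f)), (cap_eq_1 r) in Hz; [|assumption].
        rewrite Hz. apply (UMap_cut s); [apply Hs|apply Hs|apply (proj2_sig e)].
      - rewrite Rmax_left.
        + apply (UMap_cap r); [assumption|assumption|apply HfI].
        + assert (0 < / (1 - s)) by (apply Rinv_0_lt_compat; lra). unfold Rdiv. nra. }
    apply Hgm in Hle.
    rewrite (Hgu _ e ue (UMap_cut s (proj1 Hs) (proj2 Hs)) (fun _ => eq_refl)) in Hle.
    rewrite (Hgu _ f vf (UMap_cap r Hr0 Hr1) (fun _ => eq_refl)) in Hle.
    rewrite He in Hle. replace ((1 - s) / (1 - s)) with 1 in Hle by (field; lra).
    rewrite Rmax_right in Hle by lra.
    assert (r <= g f); [|lra].
    apply cap_eq_1; [assumption|]. apply Rle_antisym; [apply Rmin_l|assumption].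
  - destruct (HgI f) as [Hg0 Hg1].
    (* The case g f = 0 is split off because the rescaling divides by g f; otherwise the rescaled f
       lies in [E], and x is above its adjoint at 1. *)
    destruct Hg0 as [Hg0|<-]; [|apply HfI].
    set (uf := Uact _ (UMap_cap (g f) Hg0 Hg1) f).
    assert (HuE : E uf).
    { unfold E. rewrite (Hgu _ f uf (UMap_cap (g f) Hg0 Hg1) (fun _ => eq_refl)).
      apply cap_eq_1; lra. }
    assert (Hux : le (adj uf 1) x) by (apply Hx; now exists (exist E uf HuE)).
    apply Hadj in Hux; [|assumption]. cbn in Hux.
    apply cap_eq_1; [assumption|]. apply Rle_antisym; [apply Rmin_l|assumption].
Qed.

End Maps.

Theorem theorem5p1 (Phi Psi : PosetClass) :
  JoinDoctrine Phi -> JoinDoctrine Psi ->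
  Phi nat Peano.le ->
  SoundDual Phi Psi ->
  forall (X : Type) (le : X -> X -> Prop),
  PhiContinuousLattice Phi le ->
  OrderIsoOnto le leFun (UPsiInfMap Phi Psi le) (eta Phi le).
Proof.
  intros HPhi HPsi Homega Hsound X le HX. split; [|split].
  - intro x. apply eta_UPsiInfMap; auto. apply HX.
  - intros x x'. split.
    + intros Hxx f. apply (PhiCtsMap_mono Phi X le (proj1 HX));
        [apply (proj2_sig f)|assumption].
    (* Since x is the join of the y ≪ x, it suffices that each such y is below x'. Otherwise
       Urysohn's lemma gives f with f x = 1 and f x' = 0. *)
    + intro H. apply (DDown_PhiOf Phi HPhi X le HX x). intros y Hy. apply NNPP. intro Hyx.
      destruct (Urysohn Phi HPhi X le HX x y Hy) as [f [Hf [Hf1 Hf0]]].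
      specialize (H (exist _ f Hf)). unfold eta in H. cbn in H.
      rewrite Hf1, (Hf0 x' Hyx) in H. lra.
  - intros g Hg. apply (eta_surjective Phi Psi); auto. apply HX.
Qed.
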